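(* Let $R$ be a Noetherian domain. Then the following statements are equivalent: (1) Every finitely generated $R$-module is a cl.Hilbert module. (2) The free $R$-module $R\oplus R$ is a cl.Hilbert module. (3) $R$ is both a Hilbert ring and a Dedekind domain. (4) $R$ is a Dedekind domain with $J(R)=0$. (5) $R$ is either a field or a Dedekind domain with infinitely many maximal ideals.
   Context: All rings are commutative with identity $1\neq 0$ and all modules are unital. A proper submodule $P$ of an $R$-module $M$ is classical prime if for all $a,b\in R$ and $m\in M$, $abm\in P$ implies $am\in P$ or $bm\in P$. An $R$-module $M$ is a cl.Hilbert module (classical Hilbert module) if every classical prime submodule of $M$ is an intersection of maximal submodules of $M$. A ring $R$ is a Hilbert ring if every prime ideal of $R$ is an intersection of maximal ideals. $J(R)$ is the Jacobson radical of $R$. A Dedekind domain is an integral domain in which every proper ideal is a product of a finite number of prime ideals (so fields are Dedekind domains). *)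

(* Defs.v *)
From HB Require Import structures.
From mathcomp Require Import all_boot all_order all_algebra.
From mathcomp Require Import ring_quotient.
From mathcomp Require Import boolp classical_sets cardinality.

Set Implicit Arguments.
Unset Strict Implicit.
Unset Printing Implicit Defensive.

Import GRing.Theory.

Local Open Scope classical_set_scope.
Local Open Scope ring_scope.

Section Modules.
Variables (R : comNzRingType) (M : lmodType R).
Implicit Types (P N K : set M).

Definition submodule P : Prop := submod_closed (mem P).

Definition classical_prime P : Prop :=
  [/\ submodule P, P <> setT &
      forall (a b : R) (m : M), P ((a * b) *: m) -> P (a *: m) \/ P (b *: m)].

Definition maximal_submodule N : Prop :=
  [/\ submodule N, N <> setT &
      forall K, submodule K -> N `<=` K -> K = N \/ K = setT].

Definition clHilbert_module : Prop :=
  forall P, classical_prime P ->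
    exists2 F : set (set M), F `<=` maximal_submodule & P = \bigcap_(N in F) N.

Definition span (s : seq M) : set M :=
  [set x | exists c : 'I_(size s) -> R, x = \sum_(i < size s) c i *: s`_i].

Definition finitely_generated P : Prop := exists s : seq M, P = span s.

End Modules.

Definition finitely_generated_module (R : comNzRingType) (M : lmodType R) :
  Prop := finitely_generated [set: M].

Section Rings.
Variable R : comNzRingType.
Implicit Types (I J P : set R).

(* The ideals of R, including R itself; the library's [idealr_closed] is the
   proper ones. *)
Definition ideal I : Prop := submodule (I : set R^o).

Definition proper_idealr I : Prop := idealr_closed (mem I).

Definition prime_ideal P : Prop :=
  proper_idealr P /\ prime_idealr_closed (mem P).

Definition maximal_ideal I : Prop := maximal_submodule (I : set R^o).

Definition noetherian : Prop :=
  forall I, ideal I -> finitely_generated (I : set R^o).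

Definition Hilbert_ring : Prop :=
  forall P, prime_ideal P ->
    exists2 F : set (set R), F `<=` maximal_ideal & P = \bigcap_(I in F) I.

Definition jacobson_radical : set R := \bigcap_(I in maximal_ideal) I.

Definition ideal_mul I J : set R :=
  [set x | exists2 s : seq (R * R),
     (forall p, p \in s -> I p.1 /\ J p.2) & x = \sum_(p <- s) p.1 * p.2].

End Rings.

(* The empty product of ideals is R. *)
Definition dedekind (R : idomainType) : Prop :=
  forall I : set R, proper_idealr I ->
    exists n (P : 'I_n -> set R), (forall i, prime_ideal (P i)) /\
      I = \big[@ideal_mul R/setT]_(i < n) P i.

(* Main.v *)
(* Call a maximal ideal m locally principal if s m <= (pi) for some s outside m
   and some pi in m.  Everything goes through this property of all maximal
   ideals.

   If R + R is a cl.Hilbert module, let T be the module of relations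
   x a + y b = 0.  For m maximal, m T is classical prime, hence an intersection
   of maximal submodules, which forces T /\ m (R + R) = m T.  By Nakayama T is
   not contained in m (R + R), so one of a, b divides the other up to a factor
   outside m, and a finite set of generators of m contains a local generator.

   Local principality makes m invertible: an ideal I <= m is m (I : m), and
   Noetherian induction factors every ideal into primes.  Conversely, if ideals
   factor into primes, there is no ideal strictly between m^2 and m, so by
   Nakayama m is locally principal.

   Finally, let P be classical prime in M and z outside P.  If p = (P : z) is
   maximal, local principality gives z outside P + p M.  If p = 0, then some
   s <> 0 lies in every maximal ideal m with z in P + m M, so J(R) = 0 gives an m
   with z outside P + m M.  In both cases M / (P + m M) is a vector space, in
   which a hyperplane avoids z. *)
Require Import Defs.
From mathcomp Require Import all_boot all_order all_algebra.
From mathcomp Require Import boolp classical_sets cardinality.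
From mathcomp Require Import ring.

Import GRing.Theory.

Local Open Scope classical_set_scope.
Local Open Scope ring_scope.

Set Implicit Arguments.
Unset Strict Implicit.

(** * Submodules, spans, products with ideals, and a form of Zorn's lemma *)

Section Submodules.
Variables (R : comNzRingType) (M : lmodType R).
Implicit Types (P N K A : set M) (I : set R).

Lemma submoduleP P : submodule P <->
  P 0 /\ forall a u v, P u -> P v -> P (a *: u + v).
Proof.
split=> -[P0 PL]; split=> [|a u v].
- by move: P0; rewrite inE.
- by move=> Pu Pv; have := PL a u v; rewrite !inE; apply.
- by rewrite inE.
- by rewrite !inE; exact: PL.
Qed.

Lemma submodule0 P : submodule P -> P 0.
Proof. by case/submoduleP. Qed.

Lemma submoduleZ P a x : submodule P -> P x -> P (a *: x).
Proof.
by move=> /submoduleP[P0 PL] Px; have := PL a x 0 Px P0; rewrite addr0.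
Qed.

Lemma submoduleD P x y : submodule P -> P x -> P y -> P (x + y).
Proof. by move=> /submoduleP[P0 PL] Px /(PL 1 _ _ Px); rewrite scale1r. Qed.

Lemma submoduleB P x y : submodule P -> P x -> P y -> P (x - y).
Proof.
by move=> sP Px /(submoduleZ (- 1) sP); rewrite scaleN1r; exact: submoduleD.
Qed.

Lemma submodule_sum P (J : Type) (r : seq J) (Q : pred J) (F : J -> M) :
  submodule P -> (forall i, Q i -> P (F i)) -> P (\sum_(i <- r | Q i) F i).
Proof.
move=> sP PF; apply: big_ind => //; first exact: submodule0.
by move=> x y; exact: submoduleD.
Qed.

Lemma submodule_setT : submodule [set: M].
Proof. by apply/submoduleP. Qed.

Lemma span_submodule (s : seq M) : submodule (Defs.span s).
Proof.
apply/submoduleP; split.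
  by exists (fun=> 0); rewrite big1 // => i _; rewrite scale0r.
move=> a _ _ [c ->] [d ->]; exists (fun i => a * c i + d i).
rewrite scaler_sumr -big_split /=; apply: eq_bigr => i _.
by rewrite scalerDl scalerA.
Qed.

Lemma mem_span (s : seq M) x : x \in s -> Defs.span s x.
Proof.
move=> /[dup] xs; rewrite -index_mem => lt_s.
exists (fun i => (i == Ordinal lt_s)%:R).
rewrite (bigD1 (Ordinal lt_s)) //= eqxx scale1r nth_index //.
by rewrite big1 ?addr0 // => i /negPf ->; rewrite scale0r.
Qed.

Lemma span_sub (s : seq M) K : submodule K -> (forall x, x \in s -> K x) ->
  Defs.span s `<=` K.
Proof.
move=> sK Ks _ [c ->]; apply: submodule_sum => // i _.
by apply: submoduleZ => //; apply/Ks/mem_nth.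
Qed.

Definition adjoin N w : set M := [set x | exists r n, N n /\ x = n + r *: w].

Lemma adjoin_submodule N w : submodule N -> submodule (adjoin N w).
Proof.
move=> /submoduleP[N0 NL]; apply/submoduleP; split.
  by exists 0, 0; rewrite scale0r addr0.
move=> a _ _ [r [n [Nn ->]]] [r' [n' [Nn' ->]]].
exists (a * r + r'), (a *: n + n'); split; first exact: NL.
by rewrite scalerDr scalerDl scalerA addrACA.
Qed.

Lemma sub_adjoin N w : N `<=` adjoin N w.
Proof. by move=> n Nn; exists 0, n; rewrite scale0r addr0. Qed.

Lemma adjoin_gen N w : submodule N -> adjoin N w w.
Proof.
move=> sN; exists 1, 0; rewrite scale1r add0r; split=> //.
exact: submodule0.
Qed.

Definition submodule_add P N : set M :=
  [set x | exists y z, [/\ P y, N z & x = y + z]].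

Lemma submodule_add_submodule P N :
  submodule P -> submodule N -> submodule (submodule_add P N).
Proof.
move=> /submoduleP[P0 PL] /submoduleP[N0 NL]; apply/submoduleP; split.
  by exists 0, 0; rewrite addr0.
move=> a _ _ [y [z [Py Nz ->]]] [y' [z' [Py' Nz' ->]]].
exists (a *: y + y'), (a *: z + z'); split; [exact: PL|exact: NL|].
by rewrite scalerDr addrACA.
Qed.

(** For [M := R^o] this is convertible to [ideal_mul I K], so the facts on products of ideals below
    are mere instances. *)
Definition smul I K : set M :=
  [set z | exists2 s : seq (R * M),
     (forall p, p \in s -> I p.1 /\ K p.2) & z = \sum_(p <- s) p.1 *: p.2].

Lemma mem_smul I K r x : I r -> K x -> smul I K (r *: x).
Proof.
by move=> Ir Kx; exists [:: (r, x)]; rewrite ?big_seq1 // => p /[!inE]/eqP->.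
Qed.

Lemma smul_submodule I K : submodule K -> submodule (smul I K).
Proof.
move=> sK; apply/submoduleP; split; first by exists [::]; rewrite ?big_nil.
move=> a _ _ [s sP ->] [t tP ->].
exists ([seq (p.1, a *: p.2) | p <- s] ++ t) => [p|].
  rewrite mem_cat => /orP[/mapP[q /sP[Iq Kq] ->]|/tP//].
  by split=> //; exact: submoduleZ.
rewrite big_cat big_map scaler_sumr; congr (_ + _).
by apply: eq_bigr => p _; rewrite /= !scalerA mulrC.
Qed.

Lemma smul_sub I K A : submodule A ->
  (forall r x, I r -> K x -> A (r *: x)) -> smul I K `<=` A.
Proof.
move=> sA IKA _ [s sP ->]; rewrite big_seq; apply: submodule_sum => // p /sP[].
exact: IKA.
Qed.

Lemma smul_subr I K : submodule K -> smul I K `<=` K.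
Proof. by move=> sK; apply: smul_sub => // r x _; exact: submoduleZ. Qed.

(** Zorn's lemma is applied to the sets [X] with [A] united with [X] a submodule, rather than to the
    submodules above [A]: the union of the empty chain is empty and must qualify too. *)
Lemma submodule_Zorn A (D : set M) : submodule A -> (forall x, A x -> ~ D x) ->
  exists N, [/\ submodule N, A `<=` N, (forall x, N x -> ~ D x) &
    forall K, submodule K -> N `<=` K -> K <> N -> exists2 x, K x & D x].
Proof.
move=> sA AD.
pose Q (X : set M) := submodule (A `|` X) /\ forall x, X x -> ~ D x.
have [F QF totF|X [[sX XD] Xmax]] := @Zorn_bigcup M Q.
  split; last by move=> x [X /QF[_]]; exact.
  apply/submoduleP; split; first by left; exact: submodule0.
  (* The chain may be empty, so two elements of [A] need not have an [X] to share. *)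
  have chain (u v : M) : (A `|` \bigcup_(X in F) X) u ->
      (A `|` \bigcup_(X in F) X) v ->
      (A u /\ A v) \/ exists2 X, F X & (A `|` X) u /\ (A `|` X) v.
    move=> [Au|[X FX Xu]] [Av|[Y FY Yv]].
    - by left.
    - by right; exists Y => //; split; [left|right].
    - by right; exists X => //; split; [right|left].
    - have [XY|YX] := totF _ _ FX FY; right.
      + by exists Y => //; split; right => //; exact: XY.
      + by exists X => //; split; right => //; exact: YX.
  move=> a u v Uu /(chain _ _ Uu)[[Au Av]|[X FX [Xu Xv]]].
    by left; apply: submoduleD => //; exact: submoduleZ.
  have [sX _] := QF X FX.
  have [|Xx] : (A `|` X) (a *: u + v).
  - by apply: submoduleD => //; exact: submoduleZ.
  - by left.
  - by right; exists X.
exists (A `|` X); split=> //; first by move=> x [/AD|/XD].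
move=> K sK XK nK; apply: contrapT => KD.
apply: (Xmax K); last first.
  split; last by move=> x Kx Dx; apply: KD; exists x.
  suff -> : A `|` K = K by [].
  by apply/seteqP; split=> x; [case=> // Ax; apply: XK; left|right].
rewrite properEneq; split; last by move=> x Xx; apply: XK; right.
apply/eqP => XeK; apply: nK; rewrite -XeK.
apply/seteqP; split=> x; first by right.
by case=> // Ax; rewrite XeK; apply: XK; left.
Qed.

End Submodules.

(** * Ideals, Nakayama's lemma and the maximal condition *)

Section Ideals.
Variable R : comNzRingType.
Implicit Types (I J A : set R).

Lemma idealP I : ideal I <-> I 0 /\ forall a u v, I u -> I v -> I (a * u + v).
Proof. exact: (@submoduleP R R^o I). Qed.

Lemma setideal0 I : ideal I -> I 0.
Proof. exact: (@submodule0 R R^o I). Qed.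

Lemma setidealMl I a x : ideal I -> I x -> I (a * x).
Proof. exact: (@submoduleZ R R^o I). Qed.

Lemma setidealMr I a x : ideal I -> I x -> I (x * a).
Proof. by rewrite mulrC; exact: setidealMl. Qed.

Lemma setidealD I x y : ideal I -> I x -> I y -> I (x + y).
Proof. exact: (@submoduleD R R^o I). Qed.

Lemma ideal_eqT I : ideal I -> I 1 -> I = setT.
Proof.
move=> iI I1; apply/seteqP; split=> // x _.
by rewrite -(mulr1 x); exact: setidealMl.
Qed.

Lemma proper_idealrP I : proper_idealr I <-> ideal I /\ ~ I 1.
Proof.
split=> [[I0 I1 IL]|[/idealP[I0 IL] I1]].
  split; last by move=> I1'; move/negP: I1; rewrite inE.
  apply/idealP; split; first by move: I0; rewrite inE.
  by move=> a u v Iu Iv; have := IL a u v; rewrite !inE; apply.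
split; [by rewrite inE|by apply/negP; rewrite inE|].
by move=> a u v; rewrite !inE; exact: IL.
Qed.

Lemma prime_idealP I : prime_ideal I <->
  [/\ ideal I, ~ I 1 & forall x y, I (x * y) -> I x \/ I y].
Proof.
split=> [[/proper_idealrP[iI I1] IM]|[iI I1 IM]].
  split=> // x y Ixy; have := IM x y; rewrite !inE => /(_ Ixy).
  by case/orP; rewrite inE => ?; [left|right].
split; first exact/proper_idealrP.
move=> x y; rewrite inE => /IM[Ix|Iy]; apply/orP; rewrite !inE; by [left|right].
Qed.

Lemma maximal_ideal_notin_inv I a : maximal_ideal I -> ~ I a ->
  exists u c, I c /\ 1 = c + u * a.
Proof.
move=> [iI _ Imax] Ia.
have sK : submodule (adjoin (I : set R^o) a) by exact: adjoin_submodule.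
have IK : I `<=` adjoin (I : set R^o) a by exact: (@sub_adjoin R R^o).
have [KI|KT] := Imax _ sK IK.
  by case: Ia; rewrite -KI; exact: adjoin_gen.
have : adjoin (I : set R^o) a 1 by rewrite KT.
by move=> [r [n [In e]]]; exists r, n.
Qed.

Lemma maximal_idealP I : maximal_ideal I <->
  [/\ ideal I, ~ I 1 & forall a, ~ I a -> exists u c, I c /\ 1 = c + u * a].
Proof.
split=> [mI|[iI I1 Iinv]].
  split; [by case: mI| |by move=> a; exact: maximal_ideal_notin_inv].
  by case: mI => iI IT _ /(ideal_eqT iI).
split=> // [IT|K sK IK]; first by apply: I1; rewrite IT.
have [KI|] := pselect (K `<=` I).
  by left; apply/seteqP.
move=> /existsNP[a /not_implyP[Ka /Iinv[u [c [Ic e]]]]]; right.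
apply: (@ideal_eqT K) => //; rewrite e.
by apply: setidealD => //; [exact: IK|exact: setidealMl].
Qed.

Lemma maximal_ideal_prime I : maximal_ideal I -> prime_ideal I.
Proof.
move=> /maximal_idealP[iI I1 Iinv]; apply/prime_idealP; split=> // x y Ixy.
have [|/Iinv[u [c [Ic e]]]] := pselect (I x); [by left|right].
rewrite -[y]mul1r e mulrDl -mulrA.
by apply: setidealD => //; [exact: setidealMr|exact: setidealMl].
Qed.

Lemma exists_maximal_ideal I : ideal I -> ~ I 1 ->
  exists2 J, maximal_ideal J & I `<=` J.
Proof.
move=> iI I1.
have [x Ix /= x1|J [iJ IJ J1 Jmax]] := @submodule_Zorn _ R^o I [set 1] iI.
  by apply: I1; rewrite -x1.
exists J => //; split=> // [JT|K iK JK]; first by apply: (J1 1) => //; rewrite JT.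
have [|nKJ] := pselect (K = J); [by left|right].
by have [x + /= xE] := Jmax K iK JK nKJ; rewrite xE; exact: ideal_eqT.
Qed.

Lemma maximal_ideal_le I J :
  maximal_ideal I -> ideal J -> ~ J 1 -> I `<=` J -> I = J.
Proof.
move=> [_ _ Imax] iJ J1 IJ; have [//|JT] := Imax J iJ IJ.
by case: J1; rewrite JT.
Qed.

Lemma ideal_principal (a : R) : ideal [set x | exists y, x = a * y].
Proof.
apply/idealP; split; first by exists 0; rewrite mulr0.
by move=> b _ _ [y ->] [z ->]; exists (b * y + z); rewrite mulrDr mulrCA.
Qed.

Lemma ideal_mul_ideal I J : ideal J -> ideal (ideal_mul I J).
Proof. exact: (@smul_submodule R R^o). Qed.

Lemma mem_ideal_mul I J x y : I x -> J y -> ideal_mul I J (x * y).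
Proof. exact: (@mem_smul R R^o). Qed.

Lemma ideal_mul_sub I J A : ideal A ->
  (forall x y, I x -> J y -> A (x * y)) -> ideal_mul I J `<=` A.
Proof. exact: (@smul_sub R R^o). Qed.

Lemma ideal_mul_subl I J : ideal I -> ideal_mul I J `<=` I.
Proof. by move=> iI; apply: ideal_mul_sub => // x y Ix _; exact: setidealMr. Qed.

Lemma ideal_mul_subr I J : ideal J -> ideal_mul I J `<=` J.
Proof. by move=> iJ; apply: ideal_mul_sub => // x y _; exact: setidealMl. Qed.

(** Modulo [I] the first row is that of the identity, so the expansion along it leaves only the
    leading minor, which is handled by induction. *)
Lemma det_congr1 I n (A : 'M[R]_n) : ideal I ->
  (forall i j, I (A i j - (i == j)%:R)) -> I (\det A - 1).
Proof.
move=> iI; elim: n A => [|n IHn] A IA.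
  by rewrite det_mx00 subrr; exact: setideal0.
rewrite (expand_det_row A ord0) big_ord_recl addrAC; apply: setidealD => //.
  rewrite /cofactor /= expr0 mul1r.
  set B := row' _ _.
  have IB : I (\det B - 1).
    apply: IHn => i j; rewrite !mxE.
    by have := IA (lift ord0 i) (lift ord0 j); rewrite (inj_eq lift_inj).
  have -> : A ord0 ord0 * \det B - 1 =
    (A ord0 ord0 - 1) * \det B + (\det B - 1) by ring.
  by apply: setidealD => //; apply: setidealMr => //; exact: IA ord0 ord0.
apply: (@submodule_sum R R^o I) => // i _; apply: setidealMr => //.
by have := IA ord0 (lift ord0 i); rewrite subr0.
Qed.

(** The determinant trick relative to [A]: writing each generator of [J] modulo [A] as a combination
    of generators with coefficients in [I] gives a matrix [X], congruent to the identity modulo [I],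
    that sends the vector of generators into [A]. Multiplying by the adjugate puts [\det X] times
    each generator in [A]. It is applied with [A] zero and with [A] principal. *)
Lemma Nakayama I J A : ideal I -> ideal A ->
  finitely_generated (J : set R^o) ->
  (forall x, J x -> exists a b, [/\ A a, ideal_mul I J b & x = a + b]) ->
  exists2 c, I c & forall x, J x -> A ((1 - c) * x).
Proof.
move=> iI iA [g Jg] JAI; set n := size g.
have Jgi (i : 'I_n) : J g`_i by rewrite Jg; apply/mem_span/mem_nth.
pose L : set R^o := [set x : R^o | exists2 c : 'I_n -> R,
  (forall j, I (c j)) & x = \sum_j c j *: (g`_j : R^o)].
have sL : submodule L.
  apply/submoduleP; split.
    exists (fun=> 0); first by move=> j; exact: setideal0.
    by rewrite big1 // => i _; rewrite scale0r.
  move=> a _ _ [c Ic ->] [d Id ->]; exists (fun i => a * c i + d i).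
    by move=> j; apply: setidealD => //; exact: setidealMl.
  rewrite scaler_sumr -big_split /=; apply: eq_bigr => i _.
  by rewrite scalerDl scalerA.
have IJL : ideal_mul I J `<=` L.
  apply: (@smul_sub R R^o) => // r x Ir; rewrite Jg => -[d ->].
  exists (fun j => r * d j); first by move=> j; exact: setidealMr.
  by rewrite scaler_sumr; apply: eq_bigr => j _; rewrite scalerA.
have /choice[C HC] : forall i : 'I_n, exists c : 'I_n -> R,
    (forall j, I (c j)) /\ A (g`_i - \sum_j c j * g`_j).
  move=> i; have [a [b [Aa /IJL[c Ic bE] ->]]] := JAI _ (Jgi i).
  by exists c; split=> //; rewrite bE addrK.
pose X : 'M[R]_n := \matrix_(i, j) ((i == j)%:R - C i j).
pose v : 'cV[R]_n := \col_i g`_i.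
have IX : I (\det X - 1).
  apply: det_congr1 => // i j; rewrite mxE addrAC subrr add0r -mulN1r.
  by apply: setidealMl => //; case: (HC i).
have AXv i : A ((X *m v) i 0).
  have [_] := HC i; congr A; rewrite mxE.
  under [RHS]eq_bigr do rewrite !mxE mulrBl.
  rewrite sumrB; congr (_ - _); rewrite (bigD1 i) //= eqxx mul1r.
  by rewrite big1 ?addr0 // => j; rewrite eq_sym => /negPf->; rewrite mul0r.
exists (1 - \det X); first by rewrite -opprB -mulN1r; exact: setidealMl.
move=> x; rewrite subKr Jg => -[d ->]; rewrite mulr_sumr.
apply: (@submodule_sum R R^o A) => // i _.
rewrite /= mulrCA; apply: setidealMl => //.
have -> : \det X * g`_i = (\adj X *m (X *m v)) i 0.
  by rewrite mulmxA mul_adj_mx mul_scalar_mx !mxE.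
by rewrite mxE; apply: (@submodule_sum R R^o A) => // j _; exact: setidealMl.
Qed.

Lemma noetherian_maximal (F : set (set R)) : noetherian R ->
  F !=set0 -> F `<=` @ideal R ->
  exists2 I, F I & forall J, F J -> I `<=` J -> J = I.
Proof.
move=> noeR [I0 FI0] Fid.
have [G QG totG|X [[X0|FX] Xmax]] :=
    @Zorn_bigcup R (fun X => X = set0 \/ F X).
- have [[Y [GY FY]]|nG] := pselect (exists Y, G Y /\ F Y); last first.
    left; rewrite bigcup0 // => Y GY; have [//|FY] := QG Y GY.
    by case: nG; exists Y.
  right.
  have GF Z x : G Z -> Z x -> F Z by move=> /QG[->//|].
  have dir (u v : R) : (\bigcup_(X in G) X) u -> (\bigcup_(X in G) X) v ->
      exists2 X, G X & X u /\ X v.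
    move=> [Z GZ Zu] [W GW Wv]; have [ZW|WZ] := totG _ _ GZ GW.
      by exists W => //; split=> //; exact: ZW.
    by exists Z => //; split=> //; exact: WZ.
  have iU : ideal (\bigcup_(X in G) X).
    apply/idealP; split; first by exists Y => //; apply: setideal0; exact: Fid.
    move=> a u v Uu Uv; have [Z GZ [Zu Zv]] := dir _ _ Uu Uv.
    have iZ := Fid _ (GF _ _ GZ Zu).
    by exists Z => //; apply: setidealD => //; exact: setidealMl.
  have [s Us] := noeR _ iU.
  have [Z [GZ FZ Zs]] : exists Z, [/\ G Z, F Z & forall x, x \in s -> Z x].
    have : forall x, x \in s -> (\bigcup_(X in G) X) x.
      by move=> x; rewrite Us; exact: mem_span.
    elim: (s : seq R) => [_|x t IHt Ux]; first by exists Y.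
    have [|Z [GZ FZ Zt]] := IHt.
      by move=> y yt; apply: Ux; rewrite inE yt orbT.
    have [W GW Wx] := Ux x (mem_head _ _).
    have [ZW|WZ] := totG _ _ GZ GW.
      exists W; split=> //; first exact: GF Wx.
      by move=> y /[!inE]/orP[/eqP->//|/Zt/ZW].
    by exists Z; split=> // y /[!inE]/orP[/eqP->|/Zt//]; exact: WZ.
  suff -> : \bigcup_(X in G) X = Z by [].
  apply/seteqP; split; last by move=> x Zx; exists Z.
  by rewrite Us; apply: (@span_sub R R^o) => //; exact: Fid.
- exfalso; apply: (Xmax I0); last by right.
  rewrite X0 properEneq; split=> //; apply/eqP => I00.
  by have := setideal0 (Fid _ FI0); rewrite -I00.
- exists X => // J FJ XJ; apply: contrapT => nJX.
  apply: (Xmax J); last by right.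
  by rewrite properEneq; split=> //; apply/eqP => e; exact: nJX.
Qed.

End Ideals.

(** * The ideal (P : z) of an element *)

Section Colon.
Variables (R : comNzRingType) (M : lmodType R).
Implicit Types (P : set M).

Definition colon_elt P z : set R := [set r | P (r *: z)].

Lemma colon_elt_ideal P z : submodule P -> ideal (colon_elt P z).
Proof.
move=> /submoduleP[P0 PL]; apply/idealP; rewrite /colon_elt /=; split.
  by rewrite scale0r.
by move=> a x y Px Py; rewrite scalerDl -scalerA; exact: PL.
Qed.

End Colon.

(** * Locally principal maximal ideals, prime factorization and the Jacobson radical *)

Section Dedekind.
Variable R : idomainType.
Hypothesis noethR : noetherian R.
Implicit Types (I J m p : set R).

Lemma ideal_zero : ideal [set 0 : R].
Proof.
apply/idealP; split=> // a u v /= -> ->.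
by rewrite mulr0 addr0.
Qed.

Lemma prime_ideal_zero : prime_ideal [set 0 : R].
Proof.
apply/prime_idealP; split=> /=; first exact: ideal_zero.
  by move/eqP; rewrite oner_eq0.
by move=> x y /eqP; rewrite mulf_eq0 => /orP[]/eqP; [left|right].
Qed.

(** Nakayama gives [c] in [I] with [1 - c] killing [J]; as [I] is proper, [1 - c] is nonzero, and R
    is a domain. *)
Lemma Nakayama_zero I J : ideal I -> ~ I 1 -> ideal J ->
  J `<=` ideal_mul I J -> J `<=` [set 0].
Proof.
move=> iI I1 iJ JIJ.
have [x Jx|c Ic cJ x /cJ /= /eqP] :=
    Nakayama iI ideal_zero (noethR iJ).
  by exists 0, x; split=> //; [exact: JIJ|rewrite add0r].
rewrite mulf_eq0 subr_eq0 => /orP[/eqP c1|/eqP//].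
by case: I1; rewrite c1.
Qed.

(** For maximal [m] this says that [pi] generates [m] in the localization at [m], with one common
    denominator [s]; no localization has to be formed. *)
Definition locally_principal m := exists s pi,
  [/\ ~ m s, m pi & forall x, m x -> exists y, s * x = pi * y].

(** Take a maximal [m] above [p], with local generator [pi]. If [pi] is in [p], then s m <= p and so
    m <= p. Otherwise s x = pi y with [x] in [p] forces [y] into [p], whence p = m p, and Nakayama
    makes [p] zero. *)
Lemma prime_ideal_maximal p :
  (forall m, maximal_ideal m -> locally_principal m) ->
  prime_ideal p -> ~ (p `<=` [set 0]) -> maximal_ideal p.
Proof.
move=> lpR /prime_idealP[ip p1 pM] pn0.
have [m mm pm] := exists_maximal_ideal ip p1.
have /maximal_idealP[im m1 minv] := mm.
suff mp : m `<=` p by rewrite (_ : p = m) //; exact/seteqP.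
have [s [pi [ms mpi spi]]] := lpR m mm.
have [ppi|npi] := pselect (p pi).
  move=> x mx; have [y sx] := spi x mx.
  have [/pm//|//] : p s \/ p x.
  by apply: pM; rewrite sx; exact: setidealMr.
case: pn0; apply: (Nakayama_zero im) => // x px.
have [u [c [mc e]]] := minv s ms.
have [y sx] := spi x (pm _ px).
have py : p y.
  have [//|//] : p pi \/ p y by apply: pM; rewrite -sx; exact: setidealMl.
have -> : x = c * x + pi * (u * y).
  by rewrite -[LHS]mul1r e mulrDl -mulrA sx mulrCA.
apply: setidealD; first exact: ideal_mul_ideal.
  exact: mem_ideal_mul.
by apply: mem_ideal_mul => //; exact: setidealMl.
Qed.

(** Unlike [dedekind], this also speaks of the unit ideal, the empty product, at which the
    Noetherian induction may stop. *)
Definition prime_factored I := exists n (P : 'I_n -> set R),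
  (forall i, prime_ideal (P i)) /\ I = \big[@ideal_mul R/setT]_(i < n) P i.

Lemma prime_factoredT : prime_factored setT.
Proof. by exists 0%N, (fun=> set0); split=> [[]|] //; rewrite big_ord0. Qed.

Lemma prime_factoredM p J :
  prime_ideal p -> prime_factored J -> prime_factored (ideal_mul p J).
Proof.
move=> pp [n [P [pP ->]]].
exists n.+1, (fun i => oapp P p (unlift ord0 i)); split=> [i|].
  by case: (unlift ord0 i) => [j|] /=.
rewrite big_ord_recl unlift_none /=; congr ideal_mul.
by apply: eq_bigr => i _; rewrite liftK.
Qed.

Lemma ideal_mulT I : ideal I -> ideal_mul I setT = I.
Proof.
move=> iI; apply/seteqP; split; first exact: ideal_mul_subl.
by move=> x Ix; rewrite -[x]mulr1; exact: mem_ideal_mul.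
Qed.

Lemma dedekind_of_locally_principal :
  (forall m, maximal_ideal m -> locally_principal m) -> dedekind R.
Proof.
move=> lpR I0 pI0; apply: contrapT => nfI0.
have [| |I [pI nfI] Imax] :=
    @noetherian_maximal R [set I | proper_idealr I /\ ~ prime_factored I] noethR.
- by exists I0.
- by move=> I [/proper_idealrP[]].
have /proper_idealrP[iI I1] := pI.
(* The zero ideal is prime, hence its own factorization. *)
have In0 : ~ (I `<=` [set 0]).
  move=> I0'; apply: nfI; rewrite -(ideal_mulT iI).
  apply: prime_factoredM prime_factoredT.
  rewrite (_ : I = [set 0]); first exact: prime_ideal_zero.
  by apply/seteqP; split=> // x ->; exact: setideal0.
have [m mm Im] := exists_maximal_ideal iI I1.
have /maximal_idealP[im m1 minv] := mm.
(* This is (I : m). Once I = m K is known, K = I would give I = m I and I = 0; so [K] is strictly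
   larger than [I] and factors by maximality of [I]. *)
pose K : set R := [set w | forall y, m y -> I (w * y)].
have iK : ideal K.
  apply/idealP; split=> [y _|a u v Ku Kv y my].
    by rewrite mul0r; exact: setideal0.
  rewrite mulrDl -mulrA; apply: setidealD => //; last exact: Kv.
  by apply: setidealMl => //; exact: Ku.
have IK : I `<=` K by move=> x Ix y _; exact: setidealMr.
have ImK : I = ideal_mul m K.
  apply/seteqP; split; last first.
    by apply: ideal_mul_sub => // x y mx Ky; rewrite mulrC; exact: Ky.
  move=> z Iz; have [s [pi [ms mpi spi]]] := lpR m mm.
  have pi0 : pi != 0.
    apply/eqP => pi0; apply: In0 => x /Im/spi[y /eqP].
    rewrite pi0 mul0r mulf_eq0 => /orP[/eqP s0|/eqP//].
    by case: ms; rewrite s0; exact: setideal0.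
  have [u [c [mc e]]] := minv s ms.
  have [w sz] := spi z (Im _ Iz).
  (* For [y] in [m] with s y = pi y', both pi w y and pi z y' equal s z y; cancel [pi]. *)
  have Kw : K w.
    move=> y my; have [y' sy] := spi y my.
    have -> : w * y = z * y'.
      by apply: (mulfI pi0); rewrite mulrA -sz mulrCA -sy; ring.
    exact: setidealMr.
  have -> : z = c * z + pi * (u * w).
    by rewrite -[LHS]mul1r e mulrDl -mulrA sz mulrCA.
  apply: setidealD; first exact: ideal_mul_ideal.
    by apply: mem_ideal_mul => //; exact: IK.
  by apply: mem_ideal_mul => //; exact: setidealMl iK Kw.
apply: nfI; rewrite ImK; apply: prime_factoredM; first exact: maximal_ideal_prime.
have [/(ideal_eqT iK)->|K1] := pselect (K 1); first exact: prime_factoredT.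
apply: contrapT => nfK.
have KI : K = I by apply: Imax => //; split=> //; exact/proper_idealrP.
apply: In0; apply: (Nakayama_zero im) => //.
by rewrite -[in X in ideal_mul _ X]KI -ImK.
Qed.

Lemma ideal_prod_sub n (P : 'I_n -> set R) : (forall i, ideal (P i)) ->
  ideal (\big[@ideal_mul R/setT]_(i < n) P i) /\
  forall j, \big[@ideal_mul R/setT]_(i < n) P i `<=` P j.
Proof.
elim: n P => [|n IHn] P iP.
  by rewrite big_ord0; split=> [|[]//]; apply/idealP.
have [iQ QP] := IHn _ (fun i => iP (lift ord0 i)).
rewrite big_ord_recl; split=> [|j]; first exact: ideal_mul_ideal.
case: (unliftP ord0 j) => [k ->|->]; last exact: ideal_mul_subl.
by apply: subset_trans (QP k); exact: ideal_mul_subr.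
Qed.

Lemma prime_ideal_prod n (P : 'I_n -> set R) p : prime_ideal p ->
  \big[@ideal_mul R/setT]_(i < n) P i `<=` p -> exists i, P i `<=` p.
Proof.
move=> /prime_idealP[ip p1 pM].
elim: n P => [|n IHn] P; first by rewrite big_ord0 => /(_ 1 I).
rewrite big_ord_recl => PQp.
have [P0p|/existsNP[a /not_implyP[Pa npa]]] := pselect (P ord0 `<=` p).
  by exists ord0.
have [i Pip|i Pip] := IHn (fun i => P (lift ord0 i)); last first.
  by exists (lift ord0 i).
by have [] := pM _ _ (PQp _ (mem_ideal_mul Pa Pip)).
Qed.

(** Let [pi] lie in m but not in m^2, and K = m^2 + (pi). Every prime factor of [K] contains m^2,
    hence equals [m], so [K] is a power of [m]. The exponent is not 0 because K <= m, and not 2 or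
    more because [pi] is in [K]; so K = m, and Nakayama modulo (pi) yields [s]. *)
Lemma dedekind_locally_principal m :
  dedekind R -> maximal_ideal m -> locally_principal m.
Proof.
move=> dedR mm; have /maximal_idealP[im m1 minv] := mm.
have [m0|mn0] := pselect (m `<=` [set 0]).
  exists 1, 0; split=> //; first exact: setideal0.
  by move=> x /m0 /= ->; exists 0; rewrite !mulr0.
have /existsNP[pi /not_implyP[mpi nm2]] : ~ (m `<=` ideal_mul m m).
  by move=> mm2; apply: mn0; exact: (Nakayama_zero im).
pose K : set R := adjoin (ideal_mul m m : set R^o) pi.
have im2 : ideal (ideal_mul m m) by exact: ideal_mul_ideal.
have iK : ideal K by exact: (@adjoin_submodule R R^o).
have Kpi : K pi by exact: (@adjoin_gen R R^o).
have m2K : ideal_mul m m `<=` K by exact: (@sub_adjoin R R^o).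
have Km : K `<=` m.
  move=> _ [r [n [/(ideal_mul_subl im) mn ->]]].
  by apply: setidealD => //; exact: setidealMl.
have [|n [P [pP KP]]] := dedR K.
  by apply/proper_idealrP; split=> // /Km.
have iP i : ideal (P i) by case/prime_idealP: (pP i).
have KPi i : K `<=` P i by rewrite KP; case: (ideal_prod_sub iP).
have Pm i : P i = m.
  have /prime_idealP[_ P1 PM] := pP i; symmetry; apply: maximal_ideal_le => //.
  move=> x mx; suff [] : P i x \/ P i x by [].
  by apply: PM; apply: KPi; apply: m2K; exact: mem_ideal_mul.
have mK : m `<=` K.
  case: n P {pP iP KPi} Pm KP => [|[|n]] P Pm.
  - by rewrite big_ord0 => KT; case: m1; apply: Km; rewrite KT.
  - by rewrite big_ord_recl big_ord0 Pm ideal_mulT // => ->.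
  - rewrite 2!big_ord_recl !Pm => KP; case: nm2; move: Kpi; rewrite KP.
    apply: ideal_mul_sub => // x y mx /(ideal_mul_subl im) my.
    exact: mem_ideal_mul.
have [x mx|c mc cK] := Nakayama im (ideal_principal pi) (noethR im).
  have [r [n' [mn ->]]] := mK _ mx.
  exists (r * pi), n'; rewrite addrC; split=> //.
  by exists r; rewrite mulrC.
exists (1 - c), pi; split=> //.
by move=> m1c; apply: m1; rewrite -(subrK c 1); exact: setidealD.
Qed.

Lemma jacobson_radical_eq0 : jacobson_radical (R := R) `<=` [set 0] ->
  jacobson_radical (R := R) = [set 0].
Proof.
move=> J0; apply/seteqP; split=> // _ -> m /maximal_idealP[im _ _].
exact: setideal0.
Qed.

(** If x <> 0 were in every maximal ideal, each maximal ideal would contain one of the finitely many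
    prime factors of (x). These are nonzero, hence maximal, so they would exhaust the maximal
    ideals. *)
Lemma jacobson_radical_infinite : dedekind R ->
  infinite_set [set I : set R | maximal_ideal I] ->
  jacobson_radical (R := R) = [set 0].
Proof.
move=> dedR infR; apply: jacobson_radical_eq0 => x Jx; apply: contrapT => x0.
pose I : set R := [set z | exists y, z = x * y].
have iI : ideal I by exact: ideal_principal.
have Ix : I x by exists 1; rewrite mulr1.
have Im m : maximal_ideal m -> I `<=` m.
  move=> mm _ [y ->]; apply: setidealMr; [by case: mm|exact: Jx].
have [|n [P [pP IP]]] := dedR I.
  apply/proper_idealrP; split=> // I1.
  have /set0P/set0P[m mm] := infinite_setN0 infR.
  by have /maximal_idealP[_ m1 _] := mm; apply: m1; exact: Im I1.
have iP i : ideal (P i) by case/prime_idealP: (pP i).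
have Pmax i : maximal_ideal (P i).
  apply: prime_ideal_maximal => //.
    by move=> m; exact: dedekind_locally_principal.
  move=> P0; apply: x0; apply: P0; case: (ideal_prod_sub iP) => _; apply.
  by rewrite -IP.
apply: infR; apply: (@sub_finite_set _ _ (range P)); last exact: finite_image.
move=> m mm; have [|i Pim] := prime_ideal_prod (P := P) (maximal_ideal_prime mm).
  by rewrite -IP; exact: Im.
have /maximal_idealP[im m1 _] := mm.
by exists i => //; exact: maximal_ideal_le.
Qed.

(** If R is not a field, no maximal ideal is zero; a product of nonzero elements, one from each of
    the finitely many maximal ideals, is then a nonzero element of the radical. *)
Lemma jacobson_radical_eq0_finite : jacobson_radical (R := R) = [set 0] ->
  finite_set [set I : set R | maximal_ideal I] -> GRing.field_axiom R.
Proof.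
move=> J0 /finite_seqP[s sE] a a0; apply: contrapT => ua.
have [x x0 sx] : exists2 x : R, x != 0 & forall I, I \in s -> I x.
  have : forall I, I \in s -> maximal_ideal I.
    by move=> I sI; have : [set` s] I by []; rewrite -sE.
  elim: (s) => [_|I t IHt st]; first by exists 1; rewrite ?oner_eq0.
  have [|x x0 tx] := IHt; first by move=> J tJ; apply: st; rewrite inE tJ orbT.
  have mI : maximal_ideal I by apply: st; rewrite mem_head.
  have [I0|] := pselect (I `<=` [set 0]).
    have [|u [c [/I0 /= -> e]]] := maximal_ideal_notin_inv mI (a := a).
      by move/I0/eqP; exact/negP.
    by case: ua; apply/unitrPr; exists u; rewrite e add0r mulrC.
  move=> /existsNP[y /not_implyP[Iy /eqP y0]].
  exists (x * y); first by rewrite mulf_neq0.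
  move=> J /[!inE]/orP[/eqP->|tJ]; first by apply: setidealMl => //; case: mI.
  by apply: setidealMr; [case: (st J); rewrite ?inE ?tJ ?orbT|exact: tx].
have : jacobson_radical (R := R) x.
  by move=> I mI; apply: sx; have : [set` s] I by rewrite -sE.
by rewrite J0 => /eqP; exact/negP.
Qed.

End Dedekind.

(** * From locally principal maximal ideals to cl.Hilbert modules *)

Section HilbertModules.
Variable R : idomainType.
Implicit Types (m : set R).

(** Take [N] maximal among the submodules above [P] that avoid [z]. For [w] outside [N], some n + r
    w equals [z]; [r] is invertible modulo [m], and m M <= P, so [w] lies in N + R z. Any larger
    submodule contains [z], hence everything. *)
Lemma exists_maximal_submodule (M : lmodType R) m (P : set M) z :
  maximal_ideal m -> submodule P -> (forall c x, m c -> P (c *: x)) -> ~ P z ->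
  exists N, [/\ maximal_submodule N, P `<=` N & ~ N z].
Proof.
move=> mm sP mMP nPz.
have [x Px /= xz|N [sN PN Nz Nmax]] := @submodule_Zorn _ M P [set z] sP.
  by apply: nPz; rewrite -xz.
have nNz : ~ N z by move/Nz; exact.
exists N; split=> //; split=> // [NT|K sK NK]; first by apply: nNz; rewrite NT.
have [|nKN] := pselect (K = N); [by left|right].
have [_ /[swap] /= -> Kz] := Nmax K sK NK nKN.
apply/seteqP; split=> // w _.
have [/NK//|nNw] := pselect (N w).
have [nwN|wN] := pselect (adjoin N w = N).
  by case: nNw; rewrite -nwN; exact: adjoin_gen.
have [_ [r [n [Nn ->]]] zE] :=
  Nmax _ (adjoin_submodule w sN) (@sub_adjoin _ _ N w) wN.
have nmr : ~ m r.
  by move=> mr; apply: nNz; rewrite -zE; apply: submoduleD => //; exact/PN/mMP.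
have [u [c [mc e]]] := maximal_ideal_notin_inv mm nmr.
rewrite -[w]scale1r e scalerDl; apply: submoduleD => //; first exact/NK/PN/mMP.
rewrite -scalerA; apply: submoduleZ => //.
by rewrite -(addKr n (r *: w)) zE addrC; apply: submoduleB => //; exact: NK.
Qed.

(** Enlarge [P] to [N], maximal among submodules without nonzero multiples of [z]. Each [w] then has
    a nonzero multiple in N + R z, and finite generation gives one s <> 0 with s M <= N + R z. If
    [z] is in P + m M, then s z is in N + m z, so (s - c) z is in [N] for some [c] in [m], and s =
    c. *)
Lemma torsion_free_elt_bound (M : lmodType R) (P : set M) z :
  finitely_generated_module M -> submodule P -> colon_elt P z `<=` [set 0] ->
  exists2 s : R, s != 0 & forall m, ideal m ->
    submodule_add P (smul m [set: M]) z -> m s.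
Proof.
move=> [g gT] sP Pz.
have [x Px [r /eqP r0 rE]|N [sN PN Nz Nmax]] :=
    @submodule_Zorn _ M P [set x | exists2 r : R, r != 0 & x = r *: z] sP.
  by apply: r0; apply: Pz; rewrite /colon_elt /= -rE.
have tfz r : N (r *: z) -> r = 0.
  by move=> /Nz Nrz; apply: contrapT => /eqP r0; apply: Nrz; exists r.
have Nw w : exists2 s : R, s != 0 & adjoin N z (s *: w).
  have [Nw|nNw] := pselect (N w).
    by exists 1; rewrite ?oner_neq0 // scale1r; exact: sub_adjoin.
  have [nwN|wN] := pselect (adjoin N w = N).
    by case: nNw; rewrite -nwN; exact: adjoin_gen.
  have [_ [s [n [Nn ->]]] [r r0 e]] :=
    Nmax _ (adjoin_submodule w sN) (@sub_adjoin _ _ N w) wN.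
  exists s.
    apply/eqP => s0; move/eqP: r0; apply; apply: tfz.
    by rewrite -e s0 scale0r addr0.
  exists r, (- n); rewrite -e addKr; split=> //.
  by rewrite -sub0r; apply: submoduleB => //; exact: submodule0.
have [s s0 sg] : exists2 s : R, s != 0 & forall w, w \in g -> adjoin N z (s *: w).
  elim: (g) => [|w t [s s0 st]]; first by exists 1; rewrite ?oner_neq0.
  have [r r0 rw] := Nw w.
  exists (r * s); first by rewrite mulf_neq0.
  move=> v /[!inE]/orP[/eqP->|/st sv].
    by rewrite mulrC -scalerA; apply: submoduleZ => //; exact: adjoin_submodule.
  by rewrite -scalerA; apply: submoduleZ => //; exact: adjoin_submodule.
have sM w : adjoin N z (s *: w).
  have sS : submodule [set w | adjoin N z (s *: w)].
    have sA := adjoin_submodule z sN.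
    apply/submoduleP; split=> [|a u v Au Av] /=.
      by rewrite scaler0; exact: submodule0.
    rewrite scalerDr scalerA mulrC -scalerA.
    by apply: submoduleD => //; exact: submoduleZ.
  by apply: (span_sub sS sg); rewrite -gT.
exists s => // m im [y [q [Py mq zE]]].
pose B : set M := [set q | exists c n, [/\ m c, N n & s *: q = n + c *: z]].
have [c [n [mc Nn qE]]] : B q.
  move: mq; apply: smul_sub => [|r w mr _].
    apply/submoduleP; split.
      exists 0, 0; split; [exact: setideal0|exact: submodule0|].
      by rewrite scaler0 scale0r addr0.
    move=> a u v [c [n [mc Nn uE]]] [c' [n' [mc' Nn' vE]]].
    exists (a * c + c'), (a *: n + n'); split.
    - by apply: setidealD => //; exact: setidealMl.
    - by apply: submoduleD => //; exact: submoduleZ.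
    - rewrite scalerDr scalerA mulrC -scalerA uE vE.
      by rewrite scalerDr scalerDl scalerA addrACA.
  have [t [n [Nn wE]]] := sM w.
  exists (r * t), (r *: n); split; [exact: setidealMr|exact: submoduleZ|].
  by rewrite scalerA mulrC -scalerA wE scalerDr scalerA.
suff /eqP : s - c = 0 by rewrite subr_eq0 => /eqP->.
apply: tfz; rewrite scalerBl [in s *: z]zE scalerDr qE addrA addrK.
by apply: submoduleD => //; apply: submoduleZ => //; exact: PN.
Qed.

Lemma clHilbert_of_locally_principal (M : lmodType R) : noetherian R ->
  (forall m : set R, maximal_ideal m -> locally_principal m) ->
  jacobson_radical (R := R) = [set 0] ->
  finitely_generated_module M -> clHilbert_module M.
Proof.
move=> noethR lpR J0 fgM P [sP PT PP].
(* It remains to separate each [z] outside [P] from [P] by a maximal submodule. *)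
exists [set N | maximal_submodule N /\ P `<=` N]; first by move=> N [].
apply/seteqP; split=> [x Px N [_]|z Pz]; first exact.
apply: contrapT => nPz.
suff [m mm nz] : exists2 m : set R, maximal_ideal m &
    ~ submodule_add P (smul m [set: M]) z.
  have sT : submodule (smul m [set: M]).
    by apply: smul_submodule; exact: submodule_setT.
  have sQ : submodule (submodule_add P (smul m [set: M])).
    exact: submodule_add_submodule.
  have [c x mc|N [mN QN nNz]] := exists_maximal_submodule mm sQ _ nz.
    exists 0, (c *: x); split; [exact: submodule0|exact: mem_smul|].
    by rewrite add0r.
  apply: nNz; apply: Pz; split=> // x Px; apply: QN.
  exists x, 0; rewrite addr0; split=> //.
  exact: submodule0.
set p := colon_elt P z.
have pp : prime_ideal p.
  apply/prime_idealP; split; first exact: colon_elt_ideal.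
    by rewrite /p /colon_elt /= scale1r.
  by move=> x y; exact: PP.
have [p0|pn0] := pselect (p `<=` [set 0]).
  have [s /eqP s0 sP'] := torsion_free_elt_bound fgM sP p0.
  have : ~ jacobson_radical (R := R) s by rewrite J0.
  move=> /existsNP[m /not_implyP[mm nms]]; exists m => //.
  by move=> /sP' ms; apply: nms; apply: ms; case: mm.
have mp : maximal_ideal p by exact: prime_ideal_maximal.
exists p => // -[y [q [Py pq zE]]].
have [s [pi [nps ppi spi]]] := lpR p mp.
(* So s z = pi w modulo [P]. As pi z is in [P], so is pi pi w, and classical primeness puts pi w in
   [P]; then s z is in [P], against the choice of [s] outside [p]. *)
have [w [v [Pv qE]]] : exists w v, P v /\ s *: q = v + pi *: w.
  suff : smul p [set: M] `<=` [set q | exists w v, P v /\ s *: q = v + pi *: w].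
    exact.
  apply: smul_sub => [|r x pr _].
    apply/submoduleP; split.
      by exists 0, 0; rewrite !scaler0 addr0; split=> //; exact: submodule0.
    move=> a u u' [w [v [Pv uE]]] [w' [v' [Pv' uE']]].
    exists (a *: w + w'), (a *: v + v'); split.
      by apply: submoduleD => //; exact: submoduleZ.
    rewrite !scalerDr !scalerA [s * a]mulrC [pi * a]mulrC -!scalerA uE uE'.
    by rewrite scalerDr addrACA.
  have [r' e] := spi r pr.
  exists (r' *: x), 0; rewrite add0r !scalerA e; split=> //; exact: submodule0.
have sz : P (s *: z - pi *: w).
  rewrite zE scalerDr qE addrA addrK.
  by apply: submoduleD => //; exact: submoduleZ.
suff Pw : P (pi *: w).
  apply: nps; rewrite /p /colon_elt /= -(subrK (pi *: w) (s *: z)).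
  exact: submoduleD.
suff : P ((pi * pi) *: w) by move/PP; case.
have -> : (pi * pi) *: w = s *: (pi *: z) - pi *: (s *: z - pi *: w).
  by rewrite scalerBr !scalerA [s * pi]mulrC opprB addrC subrK.
by apply: submoduleB => //; exact: submoduleZ.
Qed.

End HilbertModules.

(** * Consequences of R + R being a cl.Hilbert module *)

Section FreeRankTwo.
Variable R : idomainType.
Local Notation M := (R^o * R^o)%type.
Implicit Types (m : set R).

Lemma finitely_generated_free2 : finitely_generated_module M.
Proof.
exists [:: (1, 0); (0, 1)] => /=; apply/seteqP; split=> // -[x y] _.
have -> : (x, y) = x *: ((1, 0) : M) + y *: ((0, 1) : M).
  by congr pair; rewrite /= /GRing.scale /= ?mulr1 ?mulr0 ?addr0 ?add0r.
apply: submoduleD; first exact: span_submodule.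
  by apply: submoduleZ; [exact: span_submodule|apply: mem_span; rewrite mem_head].
apply: submoduleZ; first exact: span_submodule.
by apply: mem_span; rewrite inE mem_head orbT.
Qed.

(** The quotient of R + R by this submodule is R/I, so the submodules above it correspond to the
    ideals above [I]. *)
Definition prodT (I : set R) : set M := [set z | I z.1].

Lemma prodT_submodule I : ideal I -> submodule (prodT I).
Proof.
move=> iI; apply/submoduleP; split; first exact: (setideal0 iI).
by move=> a u v Iu Iv; exact: (setidealD iI (setidealMl a iI Iu) Iv).
Qed.

Lemma Hilbert_ring_of_free2 : clHilbert_module M -> Hilbert_ring R.
Proof.
move=> hM P /prime_idealP[iP P1 PM].
have [|F Fmax PF] := hM (prodT P).
  split; [exact: prodT_submodule| |].
    by move=> PT; apply: P1; have : prodT P (1, 0) by rewrite PT.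
  move=> a b z; rewrite /prodT /= /GRing.scale /= => Pabz.
  have [Pa|Pbz] : P a \/ P (b * z.1) by apply: PM; rewrite mulrA.
    by left; exact: setidealMr.
  by right.
have F0 N (y : R) : F N -> N (0, y).
  by move=> FN; have : prodT P (0, y) := setideal0 iP; rewrite PF; exact.
(* Members of [F] contain 0 + R, so they are determined by their first coordinates. *)
have FN N (x y : R) : F N -> N (x, y) <-> N (x, 0).
  move=> FN; have [sN _ _] := Fmax N FN.
  split=> Nx.
    have -> : (x, 0) = ((x, y) : M) - ((0, y) : M) :> M.
      by congr pair; rewrite /= ?subr0 ?subrr.
    exact: (submoduleB sN Nx (F0 N y FN)).
  have -> : (x, y) = ((x, 0) : M) + ((0, y) : M) :> M.
    by congr pair; rewrite /= ?addr0 ?add0r.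
  exact: (submoduleD sN Nx (F0 N y FN)).
exists [set [set x | N (x, 0)] | N in F].
  move=> _ [N FN' <-]; have [sN NT Nmax] := Fmax N FN'.
  split.
  - apply/idealP; split; first exact: F0.
    move=> a u v Nu Nv /=.
    have -> : (a * u + v, 0) = a *: ((u, 0) : M) + ((v, 0) : M) :> M.
      by congr pair; rewrite /= /GRing.scale /= ?mulr0 ?addr0.
    exact: (submoduleD sN (submoduleZ a sN Nu) Nv).
  - move=> N1; apply: NT; apply/seteqP; split=> // -[x y] _; apply/FN => //.
    by have : [set x : R | N (x, 0)] x by rewrite N1.
  - move=> K iK NK; have [|KN|KT] := Nmax (prodT K) (prodT_submodule iK).
    + by move=> [x y] /(FN _ _ _ FN')/NK.
    + by left; rewrite -KN.
    + right; apply/seteqP; split=> // x _.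
      by have : prodT K (x, 0) by rewrite KT.
apply/seteqP; split=> [x Px _ [N FN' <-]|x Fx].
  by have : prodT P (x, 0) by []; rewrite PF; exact.
suff : prodT P (x, 0) by [].
by rewrite PF => N FN'; apply: (Fx [set x | N (x, 0)]); exists N.
Qed.

Lemma exists_syzygy_notin (a b : R) m : noetherian R -> clHilbert_module M ->
  maximal_ideal m -> b != 0 ->
  exists x y, x * a + y * b = 0 /\ (~ m x \/ ~ m y).
Proof.
move=> noethR hM mm b0; apply: contrapT => nT.
have /maximal_idealP[im m1 minv] := mm.
pose T : set M := [set z | z.1 * a + z.2 * b = 0].
have Tm (z : M) : T z -> m z.1 /\ m z.2.
  move=> Tz; split; apply: contrapT => nz; apply: nT; exists z.1, z.2.
    by split=> //; left.
  by split=> //; right.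
have sT : submodule T.
  apply/submoduleP; rewrite /T; split=> /=; first by rewrite !mul0r addr0.
  move=> c u v Tu Tv; rewrite /GRing.scale /=.
  have -> : (c * u.1 + v.1) * a + (c * u.2 + v.2) * b =
    c * (u.1 * a + u.2 * b) + (v.1 * a + v.2 * b) by ring.
  by rewrite Tu Tv mulr0 addr0.
pose P := smul m T.
have sP : submodule P by exact: smul_submodule.
have PT : P `<=` T by exact: smul_subr.
have T01 : ~ T (0, 1).
  by rewrite /T /= mul0r mul1r add0r => /eqP; exact/negP.
(* Two cases: T / m T is a vector space over R/m, and (R + R) / T is torsion-free. *)
have cP : classical_prime P.
  split=> //; first by move=> PT'; apply: T01; apply: PT; rewrite PT'.
  move=> r s z Prsz; have [Tz|nTz] := pselect (T z).
    have [mr|nmr] := pselect (m r); first by left; exact: mem_smul.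
    have [u [c [mc e]]] := minv r nmr.
    right; rewrite -[s *: z]scale1r e scalerDl; apply: submoduleD => //.
      by apply: mem_smul => //; exact: submoduleZ.
    by rewrite -scalerA; apply: submoduleZ => //; rewrite scalerA.
  have /eqP : r * s * (z.1 * a + z.2 * b) = 0.
    have := PT _ Prsz; rewrite /T /= /GRing.scale /= => <-; ring.
  rewrite !mulf_eq0 => /orP[/orP[/eqP r0|/eqP s0]|/eqP//].
    by left; rewrite r0 scale0r; exact: submodule0.
  by right; rewrite s0 scale0r; exact: submodule0.
have [F Fmax PF] := hM P cP.
(* If a maximal [N] above m T missed [t] in [T], then N + R t would be everything and m t <= N, so
   [N] would contain m (R + R), where [t] lies. *)
have TP : T `<=` P.
  move=> t Tt; rewrite PF => N FN; apply: contrapT => nNt.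
  have [sN NT Nmax] := Fmax N FN.
  have PN : P `<=` N by rewrite PF => x; exact.
  have [AN|AT] := Nmax _ (adjoin_submodule t sN) (@sub_adjoin _ _ N t).
    by apply: nNt; rewrite -AN; exact: adjoin_gen.
  have mN c e : m c -> N (c *: e).
    move=> mc; have : adjoin N t e by rewrite AT.
    move=> [r [n [Nn ->]]]; rewrite scalerDr scalerA mulrC -scalerA.
    apply: submoduleD => //; first exact: submoduleZ.
    by apply: submoduleZ => //; apply: PN; exact: mem_smul.
  apply: nNt; have [mt1 mt2] := Tm t Tt.
  have -> : t = t.1 *: ((1, 0) : M) + t.2 *: ((0, 1) : M).
    rewrite [LHS]surjective_pairing.
    by congr pair; rewrite /= /GRing.scale /= ?mulr1 ?mulr0 ?addr0 ?add0r.
  by apply: submoduleD => //; exact: mN.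
(* Projecting T = m T to first coordinates gives J = m J, hence J = 0; yet [J] contains [b], from
   the relation (b, -a). *)
pose J : set R := [set x | exists y, T (x, y)].
have iJ : ideal J.
  apply/idealP; split; first by exists 0; exact: (submodule0 sT).
  move=> c u v [y Ty] [y' Ty']; exists (c * y + y').
  exact: (submoduleD sT (submoduleZ c sT Ty) Ty').
have Jb : J b by exists (- a); rewrite /T /= mulNr mulrC subrr.
have /eqP b0' : b = 0.
  apply: (Nakayama_zero noethR im m1 iJ) Jb.
  move=> x [y /TP]; rewrite -[x]/((x, y) : M).1.
  suff : P `<=` [set z : M | ideal_mul m J z.1] by exact.
  apply: smul_sub => [|r z mr Tz].
    have iK := ideal_mul_ideal m iJ.
    apply/submoduleP; split; first exact: (setideal0 iK).
    by move=> c u v Ku Kv; exact: (setidealD iK (setidealMl c iK Ku) Kv).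
  by apply: mem_ideal_mul => //; exists z.2; rewrite -surjective_pairing.
by rewrite b0' in b0.
Qed.

Lemma free2_locally_principal m : noetherian R -> clHilbert_module M ->
  maximal_ideal m -> locally_principal m.
Proof.
move=> noethR hM mm; have /maximal_idealP[im m1 _] := mm.
have /prime_idealP[_ _ mM] := maximal_ideal_prime mm.
have val (a b : R) : exists2 s, ~ m s &
    (exists y, s * a = b * y) \/ (exists y, s * b = a * y).
  have [->|b0] := eqVneq b 0.
    by exists 1 => //; right; exists 0; rewrite !mulr0.
  have [x [y [/eqP]]] := exists_syzygy_notin a noethR hM mm b0.
  rewrite addr_eq0 => /eqP e [nx|ny].
    by exists x => //; left; exists (- y); rewrite e; ring.
  exists y => //; right; exists (- x).
  by rewrite mulrN mulrC [a * x]mulrC e; ring.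
have [g mg] := noethR m im.
have mem_g x : x \in g -> m x by rewrite mg; exact: (@mem_span R R^o).
(* Generators are added one at a time: a new [c] is either a local multiple of the current [pi] or
   divides it locally and replaces it. Multipliers stay outside [m] because [m] is prime. *)
have [s [pi [ms mpi spi]]] : exists s pi, [/\ ~ m s, m pi &
    forall x, x \in g -> exists y, s * x = pi * y].
  elim: (g : seq R) mem_g => [_|c t IHt ct].
    by exists 1, 0; split=> //; exact: setideal0.
  have [|s [pi [ms mpi spi]]] := IHt.
    by move=> x xt; apply: ct; rewrite inE xt orbT.
  have [r mr [[y e]|[y e]]] := val c pi.
    exists (r * s), pi; split=> //; first by move/mM => [].
    move=> x /[!inE]/orP[/eqP->|/spi[y' e']].
      by exists (s * y); rewrite mulrAC e; ring.
    by exists (r * y'); rewrite -mulrA e'; ring.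
  exists (r * s), c; split=> //; first by move/mM => [].
    by apply: ct; rewrite mem_head.
  move=> x /[!inE]/orP[/eqP->|/spi[y' e']].
    by exists (r * s); rewrite mulrC.
  by exists (y * y'); rewrite -mulrA e' mulrA e; ring.
exists s, pi; split=> // x; rewrite mg.
apply: (@span_sub R R^o g [set x | exists y, s * x = pi * y]) => //.
apply/submoduleP; split; first by exists 0; rewrite !mulr0.
move=> c u v [y e] [y' e']; exists (c * y + y').
by rewrite /GRing.scale /= mulrDr mulrCA e e'; ring.
Qed.

End FreeRankTwo.

(** * The cycle of implications *)

Unset Implicit Arguments.
Set Strict Implicit.

Theorem theorem3p6 (R : idomainType) (noethR : noetherian R) :
  [<-> (forall M : lmodType R, finitely_generated_module M ->
          clHilbert_module M);
       clHilbert_module (R^o * R^o)%type;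
       Hilbert_ring R /\ dedekind R;
       dedekind R /\ jacobson_radical (R := R) = [set 0];
       GRing.field_axiom R \/
         (dedekind R /\ infinite_set [set I : set R | maximal_ideal I])].
Proof.
tfae.
- by apply; exact: finitely_generated_free2.
- move=> hM; split; first exact: Hilbert_ring_of_free2.
  by apply: dedekind_of_locally_principal => // m; exact: free2_locally_principal.
- move=> [hR dedR]; split=> //; apply: jacobson_radical_eq0.
  have [F Fmax ->] := hR _ (prime_ideal_zero R).
  by move=> x Jx I /Fmax; exact: Jx.
- move=> [dedR J0].
  have [fin|inf] := pselect (finite_set [set I : set R | maximal_ideal I]).
    by left; exact: jacobson_radical_eq0_finite.
  by right.
- move=> [fR|[dedR infR]] M fgM; last first.
    apply: clHilbert_of_locally_principal => //.
      by move=> m; exact: dedekind_locally_principal.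
    exact: jacobson_radical_infinite.
  (* Over a field the only maximal ideal is zero, which is locally principal with s = 1 and pi =
     0. *)
  have m0 (m : set R) : maximal_ideal m -> m `<=` [set 0].
    move=> /maximal_idealP[im m1 _] x mx; apply: contrapT => /eqP x0.
    have ux := fR _ x0.
    by apply: m1; rewrite -(mulVr ux); exact: setidealMl.
  apply: clHilbert_of_locally_principal => //.
    move=> m mm; have /maximal_idealP[im m1 _] := mm.
    exists 1, 0; split=> //; first exact: setideal0.
    by move=> x /(m0 _ mm) /= ->; exists 0; rewrite !mulr0.
  apply: jacobson_radical_eq0 => x Jx.
  have [|m mm _] := exists_maximal_ideal (ideal_zero R).
    by move/eqP; rewrite oner_eq0.
  by apply: (m0 m mm); exact: Jx.
Qed.
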